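(* Let $X$ be a nonempty set. The following conditions are equivalent for every mapping $\Phi$ with the domain $X^{2}$: (i) $\Phi$ is combinatorially similar to a pseudometric. (ii) $\Phi$ is symmetric, there is $a_0 \in \Phi(X^{2})$ such that $\Phi$ is $a_0$-coherent, and the inequality $|\Phi(X^{2})| \leqslant \mathfrak{c}$ holds, where $\mathfrak{c}$ is the cardinality of the continuum.
   Context: A mapping $\Phi$ with domain $X^2$ may take values in an arbitrary set; $\Phi(X^2)$ is its image. It is symmetric if $\Phi(x,y)=\Phi(y,x)$ for all $x,y\in X$. A pseudometric on a set $Y$ is a function $d\colon Y^2\to\mathbb{R}$ that is nonnegative, symmetric, satisfies $d(x,x)=0$ for all $x\in Y$, and satisfies the triangle inequality. A mapping $\Phi$ with domain $X^2$ is combinatorially similar to a mapping $\Psi$ with domain $Y^2$ if there are bijections $f\colon\Phi(X^2)\to\Psi(Y^2)$ and $g\colon Y\to X$ such that $\Psi(x,y)=f(\Phi(g(x),g(y)))$ for all $x,y\in Y$. ''Combinatorially similar to a pseudometric'' means combinatorially similar to some pseudometric on some set $Y$. For $a_0\in\Phi(X^2)$, $\Phi$ is $a_0$-coherent if $\Phi^{-1}(a_0)=\{\langle x,y\rangle\in X^2:\Phi(x,y)=a_0\}$ is an equivalence relation on $X$ and, for all $x_1,x_2,x_3,x_4\in X$, the conditions $\Phi(x_1,x_2)=a_0$ and $\Phi(x_3,x_4)=a_0$ imply $\Phi(x_1,x_3)=\Phi(x_2,x_4)$. *)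

(* Defs.v *)
From mathcomp Require Import all_boot all_order all_algebra.
From mathcomp Require Import boolp classical_sets functions cardinality reals.
From Corelib Require Import RelationClasses.

Set Implicit Arguments.
Unset Strict Implicit.
Unset Printing Implicit Defensive.

Import Order.TTheory GRing.Theory Num.Theory.
Local Open Scope classical_set_scope.
Local Open Scope ring_scope.

Definition symmetric_mapping (X V : Type) (Phi : X * X -> V) : Prop :=
  forall x y : X, Phi (x, y) = Phi (y, x).

Definition pseudometric (R : realType) (Y : Type) (d : Y * Y -> R) : Prop :=
  [/\ forall x y : Y, 0 <= d (x, y),
      symmetric_mapping d,
      forall x : Y, d (x, x) = 0
    & forall x y z : Y, d (x, y) <= d (x, z) + d (z, y)].

(* The bijection f between the two images is represented by a total function
   on V, whose values outside range Phi are irrelevant; a bijection of the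
   images always extends to such a function as soon as W is inhabited (for
   pseudometrics, W is the type of real numbers). *)
Definition combinatorially_similar (X V Y W : Type)
    (Phi : X * X -> V) (Psi : Y * Y -> W) : Prop :=
  exists (f : V -> W) (g : Y -> X),
    [/\ set_bij (range Phi) (range Psi) f,
        bijective g
      & forall x y : Y, Psi (x, y) = f (Phi (g x, g y))].

Definition coherent (X V : Type) (a0 : V) (Phi : X * X -> V) : Prop :=
  Equivalence (fun x y : X => (Phi @^-1` [set a0]) (x, y)) /\
  (forall x1 x2 x3 x4 : X,
     Phi (x1, x2) = a0 -> Phi (x3, x4) = a0 -> Phi (x1, x3) = Phi (x2, x4)).

(* Main.v *)
(* For the converse, the values of Phi other than a0 embed injectively into an
   interval [c, 2c], and a0 is sent to 0: the triangle inequality then holds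
   trivially for three nonzero distances, and by coherence when a distance
   vanishes. *)
Require Import Defs.
From HB Require Import structures.
From mathcomp Require Import all_boot all_order all_algebra.
From mathcomp Require Import boolp classical_sets functions cardinality reals.
From mathcomp Require Import constructive_ereal.
From mathcomp Require Import lra.
From Corelib Require Import RelationClasses.

Import Order.TTheory GRing.Theory Num.Theory.

Local Open Scope classical_set_scope.

Section SimilarToPseudometric.
Set Implicit Arguments.
Unset Strict Implicit.
Unset Printing Implicit Defensive.
Local Open Scope ring_scope.

(** Four triangle inequalities close into the cycle [d (x1, x3) <= d (x2, x3) <= d (x2, x4) <= d
    (x1, x4) <= d (x1, x3)], so all four distances agree. *)
Lemma pseudometric_eq0_eq (R : realType) (Y : Type) (d : Y * Y -> R) :
  pseudometric d ->
  forall x1 x2 x3 x4, d (x1, x2) = 0 -> d (x3, x4) = 0 -> d (x1, x3) = d (x2, x4).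
Proof.
move=> [_ dC d0 dD] x1 x2 x3 x4 d12 d34.
have := dD x1 x3 x2; have := dD x2 x3 x4; have := dD x2 x4 x1.
have := dD x1 x4 x3; rewrite (dC x2 x1) (dC x4 x3) d12 d34; lra.
Qed.

Lemma pseudometric_coherent (R : realType) (Y : Type) (d : Y * Y -> R) :
  pseudometric d -> coherent 0 d.
Proof.
move=> dP; have [d_ge0 dC d0 dD] := dP; split; last exact: pseudometric_eq0_eq.
split=> [x|x y|x y z] /=; first exact: d0.
  by rewrite dC.
(* Transitivity: with [0] read as [d (y, y)], the previous lemma applies to the pairs [(x, y)] and
   [(z, y)]. *)
move=> dxy dyz; rewrite -(d0 y).
by apply: (pseudometric_eq0_eq dP); rewrite // dC.
Qed.

Lemma similar_symmetric (X V Y W : Type) (Phi : X * X -> V) (Psi : Y * Y -> W) :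
  combinatorially_similar Phi Psi -> symmetric_mapping Psi ->
  symmetric_mapping Phi.
Proof.
move=> [f [g [[_ f_inj _] [h gK hK] PsiE]]] PsiC x y.
apply: f_inj; rewrite ?inE; [by exists (x, y)|by exists (y, x)|].
by rewrite -(hK x) -(hK y) -!PsiE.
Qed.

(** As [f] is injective on [range Phi], equalities between values of [Phi] correspond under [h] to
    those between values of [Psi]; [a0] is the value that [f] sends to [b0]. *)
Lemma similar_coherent (X V Y W : Type) (Phi : X * X -> V) (Psi : Y * Y -> W)
    (b0 : W) :
  combinatorially_similar Phi Psi -> range Psi b0 -> coherent b0 Psi ->
  exists a0, range Phi a0 /\ coherent a0 Phi.
Proof.
move=> [f [g [[_ f_inj _] [h gK hK] PsiE]]] [[y1 y2] _ Psi12] [[eR eS eT] eC].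
have PhiE x y : f (Phi (x, y)) = Psi (h x, h y) by rewrite PsiE !hK.
have PhiI x y x' y' : Psi (h x, h y) = Psi (h x', h y') ->
    Phi (x, y) = Phi (x', y').
  rewrite -!PhiE; apply: f_inj; rewrite inE; [by exists (x, y)|by exists (x', y')].
have Phi0 x y : Phi (x, y) = Phi (g y1, g y2) <-> Psi (h x, h y) = b0.
  split=> [Pxy|Pxy]; first by rewrite -PhiE Pxy PhiE !gK.
  by apply: PhiI; rewrite !gK Psi12.
exists (Phi (g y1, g y2)); split; first by exists (g y1, g y2).
split; last by move=> x1 x2 x3 x4 /Phi0 P12 /Phi0 P34; apply: PhiI; apply: eC.
split=> [x|x y /Phi0 xy|x y z /Phi0 xy /Phi0 yz]; apply/Phi0.
- exact: eR.
- exact: eS.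
- exact: eT xy yz.
Qed.

Lemma coherent_similar_pseudometric (R : realType) (X V : Type)
    (Phi : X * X -> V) (a0 : V) :
  symmetric_mapping Phi -> coherent a0 Phi -> (range Phi #<= [set: R])%card ->
  exists d : X * X -> R, pseudometric d /\ combinatorially_similar Phi d.
Proof.
move=> PhiC [[eR eS eT] eC] cardPhi.
(* Extracting an injection from the cardinality bound calls for a pointed codomain. *)
pose R0 := isPointed.Build R 0.
pose Rp : pointedType := HB.pack (Real.sort R) (Real.class R) R0.
have [h h_inj] : exists h : V -> R, {in range Phi &, injective h}.
  exact/(@pcard_injP V Rp).
have e0 x : Phi (x, x) = a0 := eR x.
(* [contract] is injective with values in [[-1, 1]], so the shift by 3 lands in [[2, 4]], an
   interval [[c, 2c]] that avoids 0. *)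
pose f v : R := if `[< v = a0 >] then 0 else 3 + contract (h v)%:E.
have fa0 : f a0 = 0 by rewrite /f asboolT.
have f_bd v : v <> a0 -> 2 <= f v <= 4.
  move=> va0; rewrite /f asboolF //.
  by have := contract_le1 (h v)%:E; rewrite ler_norml; lra.
have f_eq0 v : f v = 0 -> v = a0.
  by have [//|/f_bd fv_bd f0] := pselect (v = a0); exfalso; lra.
have f_inj : {in range Phi &, injective f}.
  move=> u v uP vP; have [->|ua0] := pselect (u = a0).
    by rewrite fa0 => /esym/f_eq0.
  have [->|va0] := pselect (v = a0); first by rewrite fa0 => /f_eq0.
  rewrite /f !asboolF // => /addrI /contract_inj [].
  exact: h_inj.
exists (f \o Phi); split.
  split=> [x y|x y|x|x y z] /=.
  - by have [->|/f_bd] := pselect (Phi (x, y) = a0); [rewrite fa0|lra].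
  - by rewrite PhiC.
  - by rewrite e0.
  (* If [Phi (x, z) = a0], coherence with the pair [(y, y)] gives [Phi (x, y) = Phi (z, y)];
     symmetrically for [(z, y)] and [(x, x)]. Otherwise the right-hand side is at least 2 + 2 =
     4. *)
  - have [xz|/f_bd xz] := pselect (Phi (x, z) = a0).
      by rewrite xz fa0 add0r (eC _ _ _ _ xz (e0 y)).
    have [zy|/f_bd zy] := pselect (Phi (z, y) = a0).
      by rewrite zy fa0 addr0 (eC _ _ _ _ (e0 x) (eS _ _ zy)).
    by have [->|/f_bd] := pselect (Phi (x, y) = a0); rewrite ?fa0; lra.
exists f, id; split=> //; last by exists id.
split=> [v [p _ <-]|//|r [p _ <-]]; first by exists p.
by exists (Phi p) => //; exists p.
Qed.

End SimilarToPseudometric.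

Theorem theorem3p1 (R : realType) (X : Type) (hX : inhabited X)
    (V : Type) (Phi : X * X -> V) :
  (exists (Y : Type) (d : Y * Y -> R),
      pseudometric d /\ combinatorially_similar Phi d)
  <->
  [/\ symmetric_mapping Phi,
      exists a0 : V, range Phi a0 /\ coherent a0 Phi
    & (range Phi #<= [set: R])%card].
Proof.
split=> [[Y [d [dP Phid]]]|[PhiC [a0 [_ coh]] cardPhi]]; last first.
  by exists X; apply: coherent_similar_pseudometric PhiC coh cardPhi.
have [_ dC d0 _] := dP.
have [f [g [[_ f_inj _] [h _ _] _]]] := Phid.
split.
- exact: similar_symmetric Phid dC.
(* A point of [X] yields the point [h x] of [Y], which puts 0 in the range of [d]. *)
- case: hX => x; apply: (similar_coherent Phid _ (pseudometric_coherent dP)).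
  by exists (h x, h x).
(* [range Phi] is equipotent to its image under [f], a set of reals. *)
- rewrite -(card_le_eql (inj_card_eq f_inj)).
  exact: subset_card_le.
Qed.
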